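(* Let $Q$ be the Klein four-group and let $K$ be an elementary abelian $2$-group with $|K|>2$. Then there exists a nonflexible C-loop $C$ such that $N(C)\cong K$ and $C/N(C)\cong Q$.
   Context: A C-loop is a loop satisfying $x(y\cdot yz) = (xy\cdot y)z$. A loop is flexible if it satisfies $x\cdot yx = xy\cdot x$, and nonflexible otherwise. The nucleus $N(C)$ of a loop $C$ is the set of all $a\in C$ with $a(xy)=(ax)y$, $x(ay)=(xa)y$ and $x(ya)=(xy)a$ for all $x,y\in C$; in a C-loop it is a normal subloop. *)

(* Defs.v *)
From HB Require Import structures.
From mathcomp Require Import all_boot all_fingroup zmodp.
From mathcomp Require Import mathcomp_extra boolp classical_sets functions.
From mathcomp Require Import cardinality.

Set Implicit Arguments.
Unset Strict Implicit.
Unset Printing Implicit Defensive.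

Local Open Scope classical_set_scope.
Local Open Scope group_scope.

HB.mixin Record UMagma_isLoop C of UMagma C := {
  loop_ldiv : forall a b : C, exists! x : C, a * x = b;
  loop_rdiv : forall a b : C, exists! y : C, y * a = b
}.

#[short(type="loopType")]
HB.structure Definition Loop := {C of UMagma C & UMagma_isLoop C}.

HB.mixin Record Loop_isCLoop C of Loop C := {
  cloopP : forall x y z : C, x * (y * (y * z)) = ((x * y) * y) * z
}.

#[short(type="cLoopType")]
HB.structure Definition CLoop := {C of Loop C & Loop_isCLoop C}.

Definition flexible (C : magmaType) := forall x y : C, x * (y * x) = (x * y) * x.

(* For unital magmas with cancellation (loops and groups) such an f
   automatically maps 1 to 1. *)
Definition isomorphic (G H : magmaType) :=
  exists f : {multiplicative G -> H}, bijective f.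

(* Not {set K} with 2.-abelem: K may be infinite. *)
Definition elementary_abelian2 (K : groupType) :=
  (forall x y : K, commute x y) /\ (forall x : K, x ^+ 2 = 1).

(* On 'Z_2 the group law ( _ * _)%g is addition modulo 2. *)
Definition klein4 : finGroupType := ('Z_2 * 'Z_2)%type.

Section LoopTheory.
Variable C : loopType.
Implicit Types (a b x y : C) (A B N : set C).

Lemma loop_mulIl a : injective (fun x : C => a * x).
Proof.
move=> x y /= e; have [z [_ hz]] := loop_ldiv a (a * y).
by rewrite -(hz x e) -(hz y erefl).
Qed.

Lemma loop_mulIr a : injective (fun x : C => x * a).
Proof.
move=> x y /= e; have [z [_ hz]] := loop_rdiv a (y * a).
by rewrite -(hz x e) -(hz y erefl).
Qed.

Definition is_subloop N :=
  [/\ N 1,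
      forall a b, N a -> N b -> N (a * b),
      forall a x, N a -> N (a * x) -> N x &
      forall a y, N a -> N (y * a) -> N y].

Definition set_mul A B : set C := [set a * b | a in A & b in B].

Definition is_normal N :=
  [/\ forall x, set_mul [set x] N = set_mul N [set x],
      forall x y, set_mul [set x] (set_mul [set y] N) = set_mul [set x * y] N &
      forall x y, set_mul (set_mul N [set x]) [set y] = set_mul N [set x * y]].

End LoopTheory.

Record subloop (C : loopType) := Subloop {
  subloop_set :> set C;
  subloopP : is_subloop subloop_set
}.

Record normalSubloop (C : loopType) := NormalSubloop {
  normal_subloop :> subloop C;
  normalP : is_normal normal_subloop
}.

Record subloop_type (C : loopType) (N : subloop C) := SubloopElt {
  subloop_val :> C;
  _ : subloop_val \in subloop_set N
}.

Section SubloopType.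
Variables (C : loopType) (N : subloop C).
Local Notation S := (subloop_type N).

HB.instance Definition _ := [isSub for @subloop_val C N].
HB.instance Definition _ := [Choice of S by <:].

Lemma subloop_mul_subproof (u v : S) : val u * val v \in subloop_set N.
Proof.
have [_ mulN _ _] := subloopP N.
by rewrite inE; apply: mulN; rewrite -in_setE; apply: valP.
Qed.

Definition subloop_mul (u v : S) : S := SubloopElt (subloop_mul_subproof u v).

HB.instance Definition _ := hasMul.Build S subloop_mul.

Lemma subloop_one_subproof : (1 : C) \in subloop_set N.
Proof. by have [N1 _ _ _] := subloopP N; rewrite inE. Qed.

Definition subloop_one : S := SubloopElt subloop_one_subproof.

Lemma subloop_mul1g : left_id subloop_one (@mul S).
Proof. by move=> u; apply: val_inj; rewrite /= mul1g. Qed.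

Lemma subloop_mulg1 : right_id subloop_one (@mul S).
Proof. by move=> u; apply: val_inj; rewrite /= mulg1. Qed.

HB.instance Definition _ :=
  Magma_isUMagma.Build S subloop_mul1g subloop_mulg1.

Lemma subloop_ldiv (a b : S) : exists! x : S, a * x = b.
Proof.
have [_ _ divN _] := subloopP N.
have [x [xE _]] := loop_ldiv (val a) (val b).
have xN : x \in subloop_set N.
  rewrite inE; apply: (divN (val a)); rewrite ?xE -in_setE; exact: valP.
exists (SubloopElt xN); split=> [|y yE]; first by apply: val_inj; rewrite /= xE.
apply: val_inj; rewrite /=; apply: (@loop_mulIl _ (val a)).
by rewrite xE -yE.
Qed.

Lemma subloop_rdiv (a b : S) : exists! y : S, y * a = b.
Proof.
have [_ _ _ divN] := subloopP N.
have [x [xE _]] := loop_rdiv (val a) (val b).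
have xN : x \in subloop_set N.
  rewrite inE; apply: (divN (val a)); rewrite ?xE -in_setE; exact: valP.
exists (SubloopElt xN); split=> [|y yE]; first by apply: val_inj; rewrite /= xE.
apply: val_inj; rewrite /=; apply: (@loop_mulIr _ (val a)).
by rewrite xE -yE.
Qed.

HB.instance Definition _ := UMagma_isLoop.Build S subloop_ldiv subloop_rdiv.

End SubloopType.

Definition lcoset_of (C : loopType) (N : set C) (x : C) : set C :=
  set_mul [set x] N.

Record quotient_loop (C : loopType) (N : normalSubloop C) := QuotientElt {
  quotient_val :> set C;
  _ : quotient_val \in range (lcoset_of N)
}.

Section QuotientLoop.
Variables (C : loopType) (N : normalSubloop C).
Local Notation Q := (quotient_loop N).
Implicit Types x y z : C.

HB.instance Definition _ := [isSub for @quotient_val C N].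
HB.instance Definition _ := [Choice of Q by <:].

Lemma lcosetP x z : lcoset_of N x z <-> exists2 n, subloop_set N n & z = x * n.
Proof.
split=> [[_ -> [n Nn <-]]|[n Nn ->]]; first by exists n.
by exists x => //; exists n.
Qed.

Lemma rcosetP x z : lcoset_of N x z <-> exists2 n, subloop_set N n & z = n * x.
Proof.
have [nN _ _] := normalP N; rewrite /lcoset_of nN.
split=> [[n Nn [_ -> <-]]|[n Nn ->]]; first by exists n.
by exists n => //; exists x.
Qed.

Lemma nsubl x y n : subloop_set N n ->
  exists2 m, subloop_set N m & x * (y * n) = (x * y) * m.
Proof.
move=> Nn; apply/lcosetP; have [_ nl _] := normalP N.
rewrite /lcoset_of -nl; exists x => //; exists (y * n) => //.
by exists y => //; exists n.
Qed.

Lemma nsublV x y n : subloop_set N n ->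
  exists2 m, subloop_set N m & (x * y) * n = x * (y * m).
Proof.
move=> Nn; have [_ nl _] := normalP N.
have : lcoset_of N (x * y) ((x * y) * n) by apply/lcosetP; exists n.
by rewrite /lcoset_of -nl => -[_ -> [_ [_ -> [m Nm <-]] <-]]; exists m.
Qed.

Lemma nsubr x y n : subloop_set N n ->
  exists2 m, subloop_set N m & (n * x) * y = m * (x * y).
Proof.
move=> Nn; apply/rcosetP; have [nN _ nr] := normalP N.
rewrite /lcoset_of nN -nr; exists (n * x); last by exists y.
by exists n => //; exists x.
Qed.

Lemma nsubrV x y n : subloop_set N n ->
  exists2 m, subloop_set N m & n * (x * y) = (m * x) * y.
Proof.
move=> Nn; have [nN _ nr] := normalP N.
have : lcoset_of N (x * y) (n * (x * y)) by apply/rcosetP; exists n.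
by rewrite /lcoset_of nN -nr => -[_ [m Nm [_ -> <-]] [_ -> <-]]; exists m.
Qed.

Lemma lcoset_refl x : lcoset_of N x x.
Proof.
by apply/lcosetP; exists 1; rewrite ?mulg1 //; have [] := subloopP N.
Qed.

Lemma lcoset_eq x y : lcoset_of N x y -> lcoset_of N y = lcoset_of N x.
Proof.
have [_ mulN divN _] := subloopP N.
move=> /lcosetP[n Nn ->]; apply/seteqP; split=> z /lcosetP[m Nm ->].
  have [k Nk kE] := nsublV x n Nm.
  by apply/lcosetP; exists (n * k) => //; apply: mulN.
have [k [kE _]] := loop_ldiv n m.
have Nk : subloop_set N k by apply: (divN n); rewrite ?kE.
have [l Nl lE] := nsubl x n Nk.
by apply/lcosetP; exists l; rewrite // -kE.
Qed.

Lemma lcoset_mul x y :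
  set_mul (lcoset_of N x) (lcoset_of N y) = lcoset_of N (x * y).
Proof.
have [_ mulN _ _] := subloopP N.
apply/seteqP; split=> [_ [_ /rcosetP[n Nn ->] [v hv <-]]|].
  have [m Nm ->] := nsubr x v Nn.
  have -> : lcoset_of N (x * y) = lcoset_of N (x * v).
    apply/esym/lcoset_eq; case/lcosetP: hv => k Nk ->.
    by apply/lcosetP; have [l Nl ->] := nsubl x y Nk; exists l.
  by apply/rcosetP; exists m.
move=> z /lcosetP[n Nn ->]; have [m Nm ->] := nsublV x y Nn.
exists x; first exact: lcoset_refl.
by exists (y * m) => //; apply/lcosetP; exists m.
Qed.

Lemma quotient_mul_subproof (A B : Q) :
  set_mul (val A) (val B) \in range (lcoset_of N).
Proof.
case: A B => [A /= hA] [B /= hB]; move: hA hB.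
rewrite !inE => -[x _ <-] [y _ <-].
by exists (x * y); rewrite ?lcoset_mul.
Qed.

Definition quotient_mul (A B : Q) : Q := QuotientElt (quotient_mul_subproof A B).

HB.instance Definition _ := hasMul.Build Q quotient_mul.

Lemma coset_of_loop_subproof x : lcoset_of N x \in range (lcoset_of N).
Proof. by rewrite inE; exists x. Qed.

Definition loop_coset x : Q := QuotientElt (coset_of_loop_subproof x).

Lemma loop_cosetM x y : loop_coset (x * y) = loop_coset x * loop_coset y.
Proof. by apply: val_inj; rewrite /= lcoset_mul. Qed.

Lemma loop_coset_surj (A : Q) : exists x, A = loop_coset x.
Proof.
case: A => A hA; have [x _ xE] := set_mem hA.
by exists x; apply: val_inj; rewrite /= xE.
Qed.

Lemma quotient_mul1g : left_id (loop_coset 1) (@mul Q).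
Proof. by move=> A; have [x ->] := loop_coset_surj A; rewrite -loop_cosetM mul1g. Qed.

Lemma quotient_mulg1 : right_id (loop_coset 1) (@mul Q).
Proof. by move=> A; have [x ->] := loop_coset_surj A; rewrite -loop_cosetM mulg1. Qed.

HB.instance Definition _ :=
  Magma_isUMagma.Build Q quotient_mul1g quotient_mulg1.

Lemma loop_coset_eq x y : lcoset_of N x y -> loop_coset x = loop_coset y.
Proof. by move=> /lcoset_eq e; apply: val_inj; rewrite /= e. Qed.

Lemma loop_coset_eqP x y : loop_coset x = loop_coset y -> lcoset_of N x y.
Proof. by move=> /(congr1 val) /= ->; apply: lcoset_refl. Qed.

Lemma quotient_ldiv (A B : Q) : exists! X : Q, A * X = B.
Proof.
have [a ->] := loop_coset_surj A; have [b ->] := loop_coset_surj B.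
have [x [xE _]] := loop_ldiv a b; exists (loop_coset x).
split=> [|Y]; first by rewrite -loop_cosetM xE.
have [y ->] := loop_coset_surj Y; rewrite -loop_cosetM -xE.
move=> /esym/loop_coset_eqP/lcosetP[n Nn nE].
have [m Nm mE] := nsublV a x Nn.
apply: loop_coset_eq; apply/lcosetP; exists m => //.
by apply: (@loop_mulIl _ a); rewrite /= nE.
Qed.

Lemma quotient_rdiv (A B : Q) : exists! Y : Q, Y * A = B.
Proof.
have [a ->] := loop_coset_surj A; have [b ->] := loop_coset_surj B.
have [x [xE _]] := loop_rdiv a b; exists (loop_coset x).
split=> [|Y]; first by rewrite -loop_cosetM xE.
have [y ->] := loop_coset_surj Y; rewrite -loop_cosetM -xE.
move=> /esym/loop_coset_eqP/rcosetP[n Nn nE].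
have [m Nm mE] := nsubrV x a Nn.
apply: loop_coset_eq; apply/rcosetP; exists m => //.
by apply: (@loop_mulIr _ a); rewrite /= nE.
Qed.

HB.instance Definition _ := UMagma_isLoop.Build Q quotient_ldiv quotient_rdiv.

End QuotientLoop.

Definition nucleus_set (C : loopType) : set C :=
  [set a | forall x y : C,
     [/\ a * (x * y) = (a * x) * y,
         x * (a * y) = (x * a) * y &
         x * (y * a) = (x * y) * a]].
Arguments nucleus_set : clear implicits.

Section Nucleus.
Variable C : loopType.
Implicit Types a b x y : C.
Local Notation N := (nucleus_set C).

Lemma nucL a x y : N a -> a * (x * y) = (a * x) * y.
Proof. by move=> /(_ x y)[]. Qed.
Lemma nucM a x y : N a -> x * (a * y) = (x * a) * y.
Proof. by move=> /(_ x y)[]. Qed.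
Lemma nucR a x y : N a -> x * (y * a) = (x * y) * a.
Proof. by move=> /(_ x y)[]. Qed.

Lemma nuc1 : N 1.
Proof. by move=> x y; split; rewrite ?mul1g ?mulg1. Qed.

Lemma nuc_mul a b : N a -> N b -> N (a * b).
Proof.
move=> Na Nb x y; split.
- by rewrite -!(nucL _ _ Na) (nucL _ _ Nb).
- by rewrite -(nucL _ _ Na) (nucM _ _ Na) (nucM _ _ Nb) (nucR _ _ Nb).
- by rewrite !(nucR _ _ Nb) (nucR _ _ Na).
Qed.

Lemma nuc_inv a : N a -> exists b, [/\ N b, a * b = 1 & b * a = 1].
Proof.
move=> Na; have [b [ab _]] := loop_ldiv a 1.
have ba : b * a = 1.
  by apply: (@loop_mulIl _ a); rewrite /= (nucL _ _ Na) ab mul1g mulg1.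
exists b; split=> // x y; split.
- by apply: (@loop_mulIl _ a); rewrite /= !(nucL _ _ Na) ab !mul1g.
- rewrite -{2}[y]mul1g -ab -(nucL _ _ Na) (nucM _ _ Na) -(nucR _ _ Na) ba.
  by rewrite mulg1.
- by apply: (@loop_mulIr _ a); rewrite /= -!(nucR _ _ Na) ba !mulg1.
Qed.

Lemma nucleus_is_subloop : is_subloop N.
Proof.
split; [exact: nuc1 | exact: nuc_mul | |] => a x Na Nax.
  have [b [Nb ab ba]] := nuc_inv Na.
  have -> : x = b * (a * x) by rewrite (nucL _ _ Nb) ba mul1g.
  exact: nuc_mul.
have [b [Nb ab ba]] := nuc_inv Na.
have -> : x = (x * a) * b by rewrite -(nucR _ _ Nb) ab mulg1.
exact: nuc_mul.
Qed.

Definition nucleus_subloop : subloop C := Subloop nucleus_is_subloop.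

End Nucleus.

Section NucleusNormal.
Variable C : cLoopType.
Implicit Types a n u v w x y z : C.
Local Notation N := (nucleus_set C).

Lemma cloop_lalt y z : y * (y * z) = (y * y) * z.
Proof. by have := cloopP (1 : C) y z; rewrite !mul1g. Qed.

Lemma cloop_ralt x y : x * (y * y) = (x * y) * y.
Proof. by have := cloopP x y 1; rewrite !mulg1. Qed.

Lemma cloop_inv y : exists x : C, [/\ x * y = 1, y * x = 1,
  forall z, x * (y * z) = z & forall z, (z * y) * x = z].
Proof.
have [x [xy _]] := loop_rdiv y (1 : C).
have lip z : x * (y * z) = z.
  have [w [<- _]] := loop_ldiv y z.
  by rewrite cloopP xy mul1g.
have yx : y * x = 1 by apply: (@loop_mulIl _ x); rewrite /= lip mulg1.
exists x; split=> // z; have [w [<- _]] := loop_rdiv y z.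
by rewrite -cloopP yx mulg1.
Qed.

Lemma cloop_sqr_mid u v w : u * ((v * v) * w) = (u * (v * v)) * w.
Proof. by rewrite -cloop_lalt cloopP cloop_ralt. Qed.

Lemma cloop_sqr_inv x : exists y : C, [/\
  forall z, (x * x) * ((y * y) * z) = z,
  forall z, (y * y) * ((x * x) * z) = z,
  forall z, (z * (x * x)) * (y * y) = z &
  forall z, (z * (y * y)) * (x * x) = z].
Proof.
have [y [yx xy lx rx]] := cloop_inv x.
have ly z : x * (y * z) = z.
  by apply: (@loop_mulIl _ y); rewrite /= lx.
have ry z : (z * y) * x = z.
  by apply: (@loop_mulIr _ y); rewrite /= rx.
by exists y; split=> z; rewrite -?cloop_lalt ?cloop_ralt -?cloop_lalt
  ?ly ?lx ?rx ?ry ?ly ?lx ?rx ?ry.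
Qed.

Lemma cloop_sqr_nuc x : N (x * x).
Proof.
have [x' [l1 l2 r1 r2]] := cloop_sqr_inv x.
set a := x * x in l1 l2 r1 r2 *; set b := x' * x' in l1 l2 r1 r2 *.
move=> y z; split.
- have [y' [_ _ ly ry]] := cloop_inv y.
  have [c [_ _ lc rc]] := cloop_inv (a * y).
  have ca : c * a = y' by rewrite -{1}[a]ry lc.
  have cE : c = y' * b by rewrite -ca r1.
  apply: (@loop_mulIl _ c); rewrite /= lc cE.
  by rewrite -cloop_sqr_mid l2 ly.
- exact: cloop_sqr_mid.
- have [z' [_ _ lz rz]] := cloop_inv z.
  have [c [_ _ lc rc]] := cloop_inv (z * a).
  have ac : a * c = z' by rewrite -{1}[a]lz rc.
  have cE : c = b * z' by rewrite -ac l2.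
  apply: (@loop_mulIr _ c); rewrite /= rc cE.
  by rewrite cloop_sqr_mid r1 rz.
Qed.

Lemma nuc_conjr x y n : N n -> y * x = 1 -> (forall z, (z * x) * y = z) ->
  (forall z, y * (x * z) = z) -> (forall z, x * (y * z) = z) ->
  N ((x * n) * y) /\ N (y * (n * x)).
Proof.
move=> Nn yx rx lx ly; have [n' [Nn' nn' n'n]] := nuc_inv Nn.
have Ns := cloop_sqr_nuc y.
have ys : y = x * (y * y) by rewrite ly.
have sy : y = (y * y) * x by rewrite -cloop_lalt yx mulg1.
split.
  rewrite {1}ys (nucR _ _ Ns); apply: nuc_mul => //.
  have -> : (x * n) * x = ((x * n) * (x * n)) * n'.
    by rewrite (nucR _ _ Nn) -(nucR _ _ Nn') nn' mulg1.
  by apply: nuc_mul => //; apply: cloop_sqr_nuc.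
rewrite {1}sy -(nucL _ _ Ns); apply: nuc_mul => //.
have -> : x * (n * x) = n' * ((n * x) * (n * x)).
  by rewrite -(nucL _ _ Nn) (nucL _ _ Nn') n'n mul1g.
by apply: nuc_mul => //; apply: cloop_sqr_nuc.
Qed.

Lemma nucleus_is_normal : is_normal N.
Proof.
split=> [x|x y|x y].
- have [y [yx xy lx rx]] := cloop_inv x.
  have ly z : x * (y * z) = z.
    by apply: (@loop_mulIl _ y); rewrite /= lx.
  have ry z : (z * y) * x = z.
    by apply: (@loop_mulIr _ y); rewrite /= rx.
  apply/seteqP; split=> z.
    move=> [_ -> [n Nn <-]]; have [Nm _] := nuc_conjr Nn yx rx lx ly.
    by exists ((x * n) * y) => //; exists x => //; rewrite ry.
  move=> [n Nn [_ -> <-]]; have [_ Nm] := nuc_conjr Nn yx rx lx ly.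
  by exists x => //; exists (y * (n * x)).
- apply/seteqP; split=> z.
    move=> [_ -> [_ [_ -> [n Nn <-]] <-]].
    by exists (x * y) => //; exists n => //; rewrite (nucR _ _ Nn).
  move=> [_ -> [n Nn <-]]; exists x => //; exists (y * n).
    by exists y => //; exists n.
  by rewrite (nucR _ _ Nn).
- apply/seteqP; split=> z.
    move=> [_ [n Nn [_ -> <-]] [_ -> <-]].
    by exists n => //; exists (x * y) => //; rewrite (nucL _ _ Nn).
  move=> [n Nn [_ -> <-]]; exists (n * x); first by exists n => //; exists x.
  by exists y => //; rewrite (nucL _ _ Nn).
Qed.

Definition nucleus : normalSubloop C :=
  @NormalSubloop C (nucleus_subloop C) nucleus_is_normal.

End NucleusNormal.

(* Main.v *)
Require Import Defs.
From HB Require Import structures.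
From mathcomp Require Import all_boot all_fingroup zmodp.
From mathcomp Require Import mathcomp_extra boolp classical_sets functions.
From mathcomp Require Import cardinality.

Set Implicit Arguments.
Unset Strict Implicit.
Unset Printing Implicit Defensive.

Local Open Scope classical_set_scope.
Local Open Scope group_scope.

(* Let V = {1, u, v, w} be the Klein four-group, a an element of K and t an
   involutive automorphism of K moving a. Let V act on K through t, with u acting
   trivially and v, w acting as t. On V x K put
     (x, k)(y, l) = (x y, c(x, y) k^y l).
   Since V has exponent 2, this is a C-loop iff
     c(y, yz) c(y, z) = c(xy, y)^z c(x, y)^(yz).
   The cocycle with c(u, u) = c(v, u) = c(v, w) = a, c(u, w) = t a and c = 1
   elsewhere satisfies this, and since t a <> a the elements u, v, w are outside
   the nucleus and u, v witness nonflexibility. For t one takes the transvection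
   with axis H and center e, where H is a subgroup of index 2 avoiding a (Zorn's
   lemma) and e <> 1 lies in H, which needs |K| > 2. *)

(** * Elementary abelian 2-groups and their hyperplanes *)

Section ElementaryAbelian.
Variable K : groupType.
Hypothesis hK : elementary_abelian2 K.
Implicit Types a x y : K.

Lemma elem2_mulC x y : x * y = y * x.
Proof. exact: hK.1. Qed.

Lemma elem2_mulgg x : x * x = 1.
Proof. exact: hK.2. Qed.

Lemma elem2_mulKg x y : x * (x * y) = y.
Proof. by rewrite mulgA elem2_mulgg mul1g. Qed.

Lemma elem2_mulgK x y : x * y * y = x.
Proof. by rewrite -mulgA elem2_mulgg mulg1. Qed.

Lemma elem2_mulAC x y z : x * y * z = x * z * y.
Proof. by rewrite -!mulgA (elem2_mulC y). Qed.

(** A maximal multiplicatively closed set avoiding [a] is a subgroup, every element being its own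
    inverse, and [a] represents its only other coset. *)
Lemma elem2_hyperplane a : a <> 1 ->
  exists H : set K, [/\ ~ H a, forall x y, H x -> H y -> H (x * y) &
                        forall x, ~ H x -> H (x * a)].
Proof.
(* [P] does not ask for [1], since it must hold for the empty set, the union of the empty chain;
   maximality then puts [1] into [H]. *)
move=> a1; pose P (H : set K) := ~ H a /\ forall x y, H x -> H y -> H (x * y).
have [F FP Ft|H [[Ha HM] Hmax]] := @Zorn_bigcup _ P.
  split=> [[X FX Xa]|x y [X FX Xx] [Y FY Yy]]; first by have [] := FP _ FX.
  have [XY|YX] := Ft _ _ FX FY.
    by exists Y => //; apply: (FP _ FY).2 => //; apply: XY.
  by exists X => //; apply: (FP _ FX).2 => //; apply: YX.
have H1 : H 1.
  apply: contrapT => H1; apply: (Hmax (H `|` [set 1])).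
    by split=> [x|/(_ 1) /= h]; [left | apply: H1; apply: h; right].
  split=> [[]//|x y [Hx|->] [Hy|->]]; rewrite ?mulg1 ?mul1g;
    by [left; auto | right].
exists H; split=> // x Hx.
(* Otherwise the union of [H] and its coset by [x] is a larger closed set, and it avoids [a] because
   [a = x * h] gives [x * a = h]. *)
apply: contrapT => Hxa; apply: (Hmax (H `|` [set x * h | h in H])).
  split=> [y|h]; first by left.
  by apply: Hx; apply: h; right; exists 1; rewrite ?mulg1.
split=> [[//|[h Hh xh]]|y z [Hy|[g Hg <-]] [Hz|[h Hh <-]]].
- by apply: Hxa; rewrite -xh elem2_mulKg.
- by left; apply: HM.
- by right; exists (y * h); [apply: HM | rewrite !mulgA (elem2_mulC x)].
- by right; exists (g * z); [apply: HM | rewrite mulgA].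
- left; rewrite elem2_mulAC elem2_mulKg elem2_mulC; exact: HM.
Qed.

End ElementaryAbelian.

(** * Involutive automorphisms moving a point *)

Record twist (K : groupType) := Twist {
  twist_fun :> {multiplicative K -> K};
  twist_point : K;
  twistK : involutive twist_fun;
  twist_moves : twist_fun twist_point <> twist_point;
  twist_elem2 : elementary_abelian2 K
}.

Lemma card_gt2P (T : Type) (x0 : T) : ~ ([set: T] #<= `I_2)%card ->
  exists a b : T, [/\ a <> x0, b <> x0 & a <> b].
Proof.
move=> cT; apply: contrapT => h; apply: cT.
suff /injfunPex[f] : exists2 f : T -> nat, set_fun setT `I_2 f & set_inj setT f.
  exact: inj_card_le f.
(* Without such a pair all points other than [x0] coincide, so the indicator of [x <> x0] is
   injective. *)
exists (fun x => ~~ `[<x = x0>] : nat) => [x _|x y _ _] /=.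
  by case: asboolP.
case: asboolP => [->|nx]; case: asboolP => [->|ny] //= _.
by apply: contrapT => xy; apply: h; exists x, y.
Qed.

Lemma twist_exists (K : groupType) : elementary_abelian2 K ->
  ~ ([set: K] #<= `I_2)%card -> inhabited (twist K).
Proof.
move=> hK /(card_gt2P 1)[a [b [a1 b1 ab]]].
have [H [Ha HM Hout]] := elem2_hyperplane hK a1.
have [e He e1] : exists2 e, H e & e <> 1.
  have [Hb|/Hout Hba] := pselect (H b); first by exists b.
  (* [b] lies outside [H], so [b * a] lies inside, and it is not [1] because [a <> b]. *)
  exists (b * a) => // ba; apply: ab.
  by rewrite -[a]mul1g -ba (elem2_mulgK hK).
pose t x := if `[<H x>] then x else x * e.
have HV x y : H x -> H (x * y) -> H y.
  by move=> Hx /(HM _ _ Hx); rewrite (elem2_mulKg hK).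
have tM : {morph t : x y / x * y}.
  move=> x y; rewrite /t.
  have [Hx|nHx] := asboolP (H x); have [Hy|nHy] := asboolP (H y).
  - by rewrite asboolT //; apply: HM.
  - by rewrite asboolF ?mulgA // => /(HV _ _ Hx).
  - rewrite asboolF; first exact: elem2_mulAC.
    by rewrite (elem2_mulC hK) => /(HV _ _ Hy).
  (* As [x * a] and [y * a] lie in [H], so does their product [x * y]; the two factors [e] then
     cancel. *)
  - have Hxy : H (x * y).
      have := HM _ _ (Hout _ nHx) (Hout _ nHy).
      by rewrite mulgA (elem2_mulAC hK x) (elem2_mulgK hK).
    by rewrite asboolT // mulgA (elem2_mulAC hK x) (elem2_mulgK hK).
have tK : involutive t.
  move=> x; rewrite /t; case: (asboolP (H x)) => nHx; first by rewrite asboolT.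
  rewrite asboolF ?(elem2_mulgK hK) // => Hxe.
  by apply: nHx; apply: (HV e) => //; rewrite (elem2_mulC hK).
pose tm := isMultiplicative.Build K K t tM.
pose T : {multiplicative K -> K} := HB.pack t tm.
constructor; apply: (@Twist K T a) => //.
rewrite /= /t asboolF // => ae; apply: e1.
by apply: (mulgI a); rewrite ae mulg1.
Qed.

(** * The Klein four-group on pairs of booleans, its action on [K] and the cocycle *)

Definition vmul (x y : bool * bool) := (x.1 (+) y.1, x.2 (+) y.2).

Lemma vmulK x y : vmul x (vmul x y) = y.
Proof. by case: x y => [[] []] [[] []]. Qed.

Lemma vmulC x y : vmul x y = vmul y x.
Proof. by case: x y => [[] []] [[] []]. Qed.

Lemma vmulKr x y : vmul (vmul y x) x = y.
Proof. by rewrite vmulC (vmulC y) vmulK. Qed.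

Lemma vmul0v x : vmul (false, false) x = x.
Proof. by case: x. Qed.

Lemma vmulv0 x : vmul x (false, false) = x.
Proof. by rewrite vmulC vmul0v. Qed.

Section Action.
Variables (K : groupType) (t : twist K).
Local Notation a := (twist_point t).
Let hK := twist_elem2 t.
Implicit Types (x y z : bool * bool) (k l : K).

Definition act y k := if y.2 then t k else k.

Lemma actM y k l : act y (k * l) = act y k * act y l.
Proof. by rewrite /act; case: ifP => // _; rewrite gmulfM. Qed.

Lemma act_vmul x y k : act x (act y k) = act (vmul x y) k.
Proof. by rewrite /act; case: x y => [? []] [? []] /=; rewrite ?twistK. Qed.

Lemma actK y : involutive (act y).
Proof. by move=> k; rewrite act_vmul; case: y => [[] []]. Qed.

Lemma twist1 : t 1 = 1.
Proof. by apply: (mulgI (t 1)); rewrite -gmulfM !mulg1. Qed.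

Lemma act1 y : act y 1 = 1.
Proof. by rewrite /act twist1 if_same. Qed.

(* u, v and w are encoded as (true, false), (false, true) and (true, true). *)
Definition cocycle x y : K :=
  if y.1 && (x.1 (+) x.2) then act (false, x.1 && y.2) a else 1.

Lemma cocycle0l y : cocycle (false, false) y = 1.
Proof. by rewrite /cocycle andbF. Qed.

Lemma cocycle0r x : cocycle x (false, false) = 1.
Proof. by []. Qed.

(** In each of the 64 cases both sides are products of two elements among [1], [a] and [t a], and
    they agree once squares cancel. *)
Lemma cocycle_cloop x y z :
  cocycle y (vmul y z) * cocycle y z =
  act z (cocycle (vmul x y) y) * act (vmul y z) (cocycle x y).
Proof.
have tt := elem2_mulgg hK.
by case: x y z => [[] []] [[] []] [[] []];
  rewrite /cocycle /act /= ?twist1 ?twistK ?mulg1 ?mul1g ?tt.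
Qed.

End Action.

(** * Identification with [klein4] and the first isomorphism theorem *)

Definition klein4_of (x : bool * bool) : klein4 :=
  (inZp x.1 : 'Z_2, inZp x.2 : 'Z_2).

Lemma klein4_ofM : {morph klein4_of : x y / vmul x y >-> x * y}.
Proof. by move=> [[] []] [[] []]; apply/eqP. Qed.

Lemma klein4_of_bij : bijective klein4_of.
Proof.
exists (fun q : klein4 => (q.1 == 1%N :> nat, q.2 == 1%N :> nat)).
  by move=> [[] []].
by move=> [[[|[|//]] i] [[|[|//]] j]]; apply/eqP.
Qed.

(** Evaluating [g] on a chosen representative of each coset does not depend on the choice, the
    cosets of [N] being the fibres of [g]. *)
Lemma quotient_isomorphic (D : loopType) (N : normalSubloop D) (H : magmaType)
    (g : D -> H) :
    {morph g : p q / p * q >-> p * q} -> (forall h, exists p, g p = h) ->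
    (forall p q, lcoset_of N p q <-> g p = g q) ->
  isomorphic (quotient_loop N) H.
Proof.
move=> gM gsurj gN.
pose r (A : quotient_loop N) := projT1 (cid (loop_coset_surj A)).
have rK A : loop_coset N (r A) = A by rewrite /r; case: cid.
pose f A := g (r A).
have fE p : f (loop_coset N p) = g p.
  by apply/gN/loop_coset_eqP/rK.
have fM : {morph f : A B / A * B >-> A * B}.
  by move=> A B; rewrite -(rK A) -(rK B) -loop_cosetM !fE gM.
pose fm := isMultiplicative.Build _ _ f fM.
pose F : {multiplicative quotient_loop N -> H} := HB.pack f fm.
pose s h := projT1 (cid (gsurj h)).
have sK h : g (s h) = h by rewrite /s; case: cid.
exists F; exists (fun h => loop_coset N (s h)) => [A|h] /=; last by rewrite fE.
rewrite -[RHS]rK; apply: loop_coset_eq; apply/gN; exact: sK.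
Qed.

(** * The extension of the four-group by [K] *)

(** Keeping [t] in the type lets the loop structure, which depends on [t], be attached to it. *)
Definition cext (K : groupType) (t : twist K) : Type := (bool * bool * K)%type.

Section Extension.
Variables (K : groupType) (t : twist K).
Local Notation C := (cext t).
Let hK := twist_elem2 t.

HB.instance Definition _ := Choice.on C.

Definition cext_mul (p q : C) : C :=
  (vmul p.1 q.1, cocycle t p.1 q.1 * act t q.1 p.2 * q.2).

HB.instance Definition _ := hasMul.Build C cext_mul.

Lemma cext_mulE (p q : C) :
  p * q = (vmul p.1 q.1, cocycle t p.1 q.1 * act t q.1 p.2 * q.2) :> C.
Proof. by []. Qed.

Definition cext_base (k : K) : C := ((false, false), k).

Lemma cext_mul1g : left_id (cext_base 1) (@mul C).
Proof.
by move=> [[x y] k]; rewrite cext_mulE /= cocycle0l act1 !mul1g.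
Qed.

Lemma cext_mulg1 : right_id (cext_base 1) (@mul C).
Proof. by move=> [[[] []] k]; rewrite cext_mulE /= !mul1g mulg1. Qed.

HB.instance Definition _ := Magma_isUMagma.Build C cext_mul1g cext_mulg1.

Lemma cext_ldiv (p q : C) : exists! r : C, p * r = q.
Proof.
case: p q => [x k] [y l].
exists (vmul x y, (cocycle t x (vmul x y) * act t (vmul x y) k)^-1 * l).
split=> [|[z m] [<- <-]]; first by rewrite cext_mulE /= vmulK mulKVg.
by rewrite vmulK mulKg.
Qed.

Lemma cext_rdiv (p q : C) : exists! r : C, r * p = q.
Proof.
case: p q => [x k] [y l].
(* The second coordinate solves [l = c * act t x m * k] for [m], the action of [x] being its own
   inverse. *)
exists (vmul y x, act t x ((cocycle t (vmul y x) x)^-1 * (l * k^-1))).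
split=> [|[z m] [<- <-]].
  by rewrite cext_mulE /= vmulKr actK mulKVg mulgKV.
by rewrite vmulKr mulgK mulKg actK.
Qed.

HB.instance Definition _ := UMagma_isLoop.Build C cext_ldiv cext_rdiv.

Lemma cext_cloop (p q r : C) : p * (q * (q * r)) = ((p * q) * q) * r.
Proof.
case: p q r => [x k] [y l] [z m].
have mulAC := elem2_mulAC hK.
rewrite !cext_mulE /= vmulK vmulKr; congr (_, _).
(* Both second coordinates contain [c(x, z)], [k] under [z], [l] under [y z] and under [z], and [m];
   what remains is [cocycle_cloop]. *)
rewrite !actM !act_vmul !mulgA vmulKr (vmulC z y).
rewrite (mulAC _ (act t (vmul y z) l)); congr (_ * _ * _ * _).
rewrite -(mulgA _ _ (cocycle t y z)).
by rewrite (cocycle_cloop t x) mulgA (mulAC _ (act t z k)) (mulAC _ (act t z k)).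
Qed.

HB.instance Definition _ := Loop_isCLoop.Build C cext_cloop.

Local Notation u := ((true, false, 1) : C).
Local Notation v := ((false, true, 1) : C).

Lemma cext_nonflexible : ~ flexible C.
Proof.
move=> /(_ u v) /(congr1 snd).
(* The second coordinate is [t a * a] for [u * (v * u)] and [1] for [(u * v) * u]. *)
rewrite !cext_mulE /= /cocycle /act /= ?twist1 !(mulg1, mul1g) => e.
apply: (@twist_moves _ t).
by rewrite -[LHS](elem2_mulgK hK _ (twist_point t)) e mul1g.
Qed.

Lemma cext_nucleusP (p : C) : nucleus_set C p <-> p.1 = (false, false).
Proof.
have mulAC := elem2_mulAC hK; have ta := @twist_moves _ t.
have mulC := elem2_mulC hK.
split=> [|].
  (* For [p] over [w], [u], [v] in turn, the equations [u(pu) = (up)u], [p(vu) = (pv)u] and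
     [p(uv) = (pu)v] each force [t a = a]. *)
  case: p => [[[] []] k] // nuc.
  - have [_ /(congr1 snd) + _] := nuc u u.
    rewrite !cext_mulE /= /cocycle /act /= ?twist1 !(mulg1, mul1g).
    rewrite mulgA => /esym e.
    case: ta; apply: (mulgI (twist_point t)).
    by rewrite (elem2_mulgg hK); apply: (mulIg k); rewrite e mul1g.
  - have [/(congr1 snd) + _ _] := nuc v u.
    rewrite !cext_mulE /= /cocycle /act /= ?twist1 !(mulg1, mul1g).
    rewrite mulAC => e.
    case: ta; apply: (mulIg (twist_point t)).
    by rewrite (elem2_mulgg hK); apply: (mulIg (t k)); rewrite e mul1g.
  - have [/(congr1 snd) + _ _] := nuc u v.
    rewrite !cext_mulE /= /cocycle /act /= ?twist1 !(mulg1, mul1g) gmulfM.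
    by rewrite mulC => e; case: ta; apply: (mulIg (t k)); rewrite -e mulC.
case: p => [x k] /= -> [y l] [z m].
have act0 n : act t (false, false) n = n by [].
split; rewrite !cext_mulE /= ?cocycle0l ?cocycle0r !(vmul0v, vmulv0) ?act0 !mul1g.
- rewrite actM act_vmul (vmulC z) !mulgA; congr (_, _ * _ * _); exact: mulC.
- by rewrite actM !mulgA.
- by rewrite !mulgA.
Qed.

(** Over the identity of the four-group the cocycle and the action are trivial, so the second
    coordinate is a morphism, with inverse [cext_base]. *)
Lemma cext_nucleus_iso : isomorphic (subloop_type (nucleus C)) K.
Proof.
pose f (p : subloop_type (nucleus C)) : K := (val p).2.
have val1 (p : subloop_type (nucleus C)) : (val p).1 = (false, false).
  by apply/cext_nucleusP/set_mem/valP.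
have fM : {morph f : p q / p * q >-> p * q}.
  move=> p q; rewrite /f.
  change (((val p : C) * (val q : C)).2 = (val p).2 * (val q).2).
  by rewrite cext_mulE /= !val1 mul1g.
pose fm := isMultiplicative.Build _ _ f fM.
pose F : {multiplicative subloop_type (nucleus C) -> K} := HB.pack f fm.
have baseN k : cext_base k \in subloop_set (nucleus C).
  by apply/mem_set/cext_nucleusP.
exists F; exists (fun k => SubloopElt (baseN k)) => [p|//].
by apply: val_inj; rewrite /= /f /cext_base -(val1 p) -surjective_pairing.
Qed.

Lemma cext_quotient_iso : isomorphic (quotient_loop (nucleus C)) klein4.
Proof.
have [h hK' Kh] := klein4_of_bij.
apply: (@quotient_isomorphic C _ _ (fun p : C => klein4_of p.1)).
- by move=> p q; rewrite cext_mulE klein4_ofM.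
- by move=> q; exists (h q, 1); rewrite /= Kh.
move=> p q; split.
  move=> /Defs.lcosetP[n /cext_nucleusP n1 ->].
  by rewrite cext_mulE /= n1 vmulv0.
move=> /(can_inj hK') pq; apply/Defs.lcosetP.
(* The solution of [p * r = q] lies over the identity because [p] and [q] have the same first
   coordinate. *)
have [r [rE _]] := loop_ldiv p q; exists r => //; apply/cext_nucleusP.
move: pq; rewrite -rE cext_mulE /= => /(congr1 (vmul p.1)).
by rewrite vmulK => <-; case: (p.1) => [[] []].
Qed.

End Extension.

Theorem lemma5p9 (K : groupType) (hK : elementary_abelian2 K)
    (cardK : ~ is_true ([set: K]%classic #<= (`I_2)%classic)%card) :
  exists C : cLoopType,
    [/\ ~ flexible C,
        isomorphic (subloop_type (nucleus C)) K &
        isomorphic (quotient_loop (nucleus C)) klein4].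
Proof.
have [t] := twist_exists hK cardK.
exists (cext t : cLoopType); split.
- exact: cext_nonflexible.
- exact: cext_nucleus_iso.
- exact: cext_quotient_iso.
Qed.
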